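(* Let $\tau\in\mathcal T$ and $u,v\in(0,\infty)$. Then each of the following inequalities holds, provided the denominator occurring in it is not $0$: (i) $L_\tau^*\ge 2\,\dfrac{\tau(u)-\tau(0)}{u\,\tau'(u)}$; (ii) $L_\tau^*\ge \dfrac{\tau(2u)-\tau(0)}{2u\,\tau'(u)}$; (iii) $L_\tau^*\ge \dfrac{\tau'(u)-\tau'(v)}{\tau'(|u-v|)}$; (iv) $L_\tau^*\ge \dfrac{\tau'(u)+\tau'(v)}{\tau'(u+v)}$.
   Context: A differentiable function $\tau\colon(0,\infty)\to\mathbb R$ is called a quadruple transformation if there is a constant $L_\tau\in[0,\infty)$ such that for every metric space $(\mathcal Q,d)$ and all pairwise distinct points $y,z,q,p\in\mathcal Q$ with $$d(y,q)^2-d(y,p)^2-d(z,q)^2+d(z,p)^2\le 2\,d(q,p)\,d(y,z)$$ one also has $$\tau(d(y,q))-\tau(d(y,p))-\tau(d(z,q))+\tau(d(z,p))\le L_\tau\,d(q,p)\,\tau'(d(y,z)).$$ $\mathcal T$ is the set of all quadruple transformations. For $\tau\in\mathcal T$, the quadruple constant $L_\tau^*$ is the smallest constant $L_\tau\in[0,\infty)$ with this property (it exists). One sets $\tau(0):=\lim_{x\searrow0}\tau(x)$ and $\tau'(0):=\liminf_{x\searrow0}\tau'(x)$. *)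

(* Defs.v *)
From HB Require Import structures.
From mathcomp Require Import all_boot all_order all_algebra.
From mathcomp Require Import all_classical all_reals all_analysis.

Set Implicit Arguments.
Unset Strict Implicit.
Unset Printing Implicit Defensive.

Import Order.TTheory GRing.Theory Num.Theory.
Import numFieldNormedType.Exports.

Local Open Scope classical_set_scope.
Local Open Scope ring_scope.

(* A function on (0, +oo) is represented by a total function [tau : R -> R];
   nothing below depends on its values on (-oo, 0]: distances between distinct
   points are positive, a derivative at [x > 0] is local, and [0^'+] is the
   filter of punctured right neighbourhoods of 0. *)

Definition quadruple_bound (R : realType) (tau : R -> R) (L : R) : Prop :=
  forall (Q : metricType R) (y z q p : Q), uniq [:: y; z; q; p] ->
    mdist y q ^+ 2 - mdist y p ^+ 2 - mdist z q ^+ 2 + mdist z p ^+ 2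
      <= 2 * mdist q p * mdist y z ->
    tau (mdist y q) - tau (mdist y p) - tau (mdist z q) + tau (mdist z p)
      <= L * mdist q p * derive1 tau (mdist y z).

Definition quadruple_bounds (R : realType) (tau : R -> R) : set R :=
  [set L | 0 <= L /\ quadruple_bound tau L].

Definition quadruple_transformation (R : realType) (tau : R -> R) : Prop :=
  (forall x : R, 0 < x -> derivable tau x 1) /\ quadruple_bounds tau !=set0.

(* This infimum is a minimum: see [quadruple_constP]. *)
Definition quadruple_const (R : realType) (tau : R -> R) : R :=
  inf (quadruple_bounds tau).

Lemma quadruple_constP (R : realType) (tau : R -> R) :
  quadruple_transformation tau ->
  quadruple_bounds tau (quadruple_const tau) /\
  (forall L, quadruple_bounds tau L -> quadruple_const tau <= L).
Proof.
move=> [_ ne].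
have lb0 : lbound (quadruple_bounds tau) 0 by move=> L [].
have lbP L : quadruple_bounds tau L -> quadruple_const tau <= L.
  by move=> LB; apply: ge_inf => //; exists 0.
split=> //; split; first exact: lb_le_inf.
move=> Q y z q p yzqp h.
have [L0 L0B] := ne.
have [d_le0|d_gt0] := leP (mdist q p * derive1 tau (mdist y z)) 0.
  apply: (le_trans (L0B.2 Q y z q p yzqp h)).
  by rewrite -!mulrA ler_wnM2r// lbP.
rewrite -mulrA -ler_pdivrMr//; apply: lb_le_inf => // L [_ LB].
by rewrite ler_pdivrMr// mulrA; exact: LB.
Qed.

(* [tau(0)], as an element of the extended reals *)
Definition value_at0 (R : realType) (tau : R -> R) : \bar R :=
  lim ((tau x)%:E @[x --> 0^'+]).

(* [tau'] extended to 0 by its inferior limit, which may be infinite *)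
Definition derive_ext (R : realType) (tau : R -> R) (x : R) : \bar R :=
  if x == 0 then limf_einf (fun t => (derive1 tau t)%:E) 0^'+
  else (derive1 tau x)%:E.

(* Main.v *)
Require Import Defs.
From HB Require Import structures.
From mathcomp Require Import all_boot all_order all_algebra.
From mathcomp Require Import all_classical all_reals all_analysis.
From mathcomp Require Import ring lra.

Import Order.TTheory GRing.Theory Num.Theory.
Import numFieldNormedType.Exports.

Local Open Scope classical_set_scope.
Local Open Scope ring_scope.

(** All four lower bounds come from quadruples on the real line, where the
    hypothesis on squared distances holds for any four points: its left-hand
    side is [2 * (q - p) * (z - y)].  A bound [L] therefore controls [tau] at
    all collinear quadruples ([quadruple_bound_line]).

    For (iii) and (iv), take [y = 0], [z = u - s * v] with [s = 1] or [s = -1],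
    [p = u] and [q = u + c * h] with [c = 1] or [c = -1].  The points [p] and
    [q] are at distances [u] and [|u + c * h|] from [y], and [v] and
    [|v + s * c * h|] from [z].  Dividing by [h] and letting [h] tend to 0 gives
    [|tau'(u) - s * tau'(v)| <= L * tau'(|u - s * v|)]
    ([derive1_combination_le]).

    With [s = -1] and [u = v] this also says [2 * |tau'(t)| <= L * tau'(2 * t)].
    So as soon as [tau'] has a nonzero value, [L] is positive and [tau'] is
    nonnegative everywhere ([derive1_ge0]): a nonzero denominator is positive,
    and [tau] is nondecreasing, which makes the limit [tau(0)] exist in the
    extended reals.

    For (i), the quadruple [y = 0], [z = u], [q = u + h], [p = h] gives
    [tau(u + h) + tau(u - h) - 2 * tau(h) <= L * u * tau'(u)]; for (ii), the
    quadruple [y = 0], [z = u], [q = 2 * u], [p = h] gives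
    [tau(2 * u) - tau(h) - tau(u) + tau(u - h) <= L * (2 * u - h) * tau'(u)].
    Each one bounds [tau(h)] from below by an expression that converges as [h]
    decreases to 0, hence bounds [tau(0)] from below ([value_at0_ge]); this
    excludes the value -oo and yields the two inequalities. *)

(** On the line the squared distances satisfy
    [(q - y)^2 - (p - y)^2 - (q - z)^2 + (p - z)^2 = 2 * (q - p) * (z - y)],
    so the premise of [quadruple_bound] is automatic. *)
Lemma quadruple_bound_line {R : realType} {tau : R -> R} {L : R} (y z q p : R) :
  quadruple_bound tau L -> uniq [:: y; z; q; p] ->
  tau `|q - y| - tau `|p - y| - tau `|q - z| + tau `|p - z|
    <= L * `|q - p| * derive1 tau `|z - y|.
Proof.
move=> tauL yzqp; rewrite (distrC q p); apply: (tauL R^o y z q p yzqp).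
rewrite /mdist/= (distrC p q) !real_normK ?num_real// -mulrA -normrM.
apply: (@le_trans _ _ (2 * ((q - p) * (z - y)))); first by lra.
by rewrite ler_pM2l//; exact: ler_norm.
Qed.

Lemma is_derive_shift {R : realType} {f : R -> R} (x c : R) :
  derivable f x 1 ->
  is_derive (0 : R) 1 (fun h => f (x + c * h)) (c * derive1 f x).
Proof.
move=> dfx.
have dg : is_derive (0 : R) 1 (fun h => x + c * h) c.
  by apply: is_derive_eq; rewrite add0r mul1r /GRing.scale/= mulr1.
have dfx' : is_derive ((fun h => x + c * h) 0) 1 f (derive1 f x).
  by rewrite mulr0 addr0 derive1E; apply/derivableP.
have := @is_derive1_comp _ f (fun h => x + c * h) 0 _ _ dfx' dg.
by rewrite mulrC.
Qed.

Lemma cvg_shift_at_right {R : realType} {f : R -> R} (x c : R) :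
  derivable f x 1 -> f (x + c * h) @[h --> 0^'+] --> f x.
Proof.
move=> /(is_derive_shift _ c) [+ _] => /derivable1_diffP/differentiable_continuous.
by move=> /cvg_at_right_filter; rewrite mulr0 addr0.
Qed.

Lemma derive_le_slope {R : realType} {g : R -> R} {d M : R} :
  is_derive (0 : R) 1 g d ->
  (\forall h \near 0^'+, g h - g 0 <= h * M) -> d <= M.
Proof.
move=> [dg <-] gM.
have dgr : h^-1 *: (g (h *: 1 + 0) - g 0) @[h --> 0^'+] --> 'D_1 g 0.
  by apply: cvg_dnbhs_at_right; exact: dg.
apply: (ler_cvg_to dgr (cvg_cst M)).
near=> h; have h0 : 0 < h by near: h; exact: nbhs_right_gt.
rewrite addr0 /GRing.scale/= mulr1 ler_pdivrMl//.
by near: h; exact: gM.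
Unshelve. all: by end_near. Qed.

(** The derivative at [h = 0] of the bound for the collinear quadruple [0],
    [u - s * v], [u + c * h], [u].  The sign [s] puts the second point on one
    side or the other of [u], so that one statement covers the difference and
    the sum of two values of [tau']. *)
Lemma derive1_combination_le {R : realType} {tau : R -> R} {L : R} (u v s : R) :
  (forall x, 0 < x -> derivable tau x 1) -> quadruple_bound tau L ->
  0 < u -> 0 < v -> `|s| = 1 -> u - s * v != 0 ->
  `|derive1 tau u - s * derive1 tau v| <= L * derive1 tau `|u - s * v|.
Proof.
move=> dtau tauL u0 v0 s1 w0.
have ss : s * s = 1 by rewrite -expr2 -real_normK ?num_real// s1 expr1n.
(* Moving [q] away from [p = u] in the two directions [c = 1] and [c = -1]
   bounds the combination from both sides. *)
suff H (c : R) : `|c| = 1 ->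
    c * derive1 tau u - s * c * derive1 tau v <= L * derive1 tau `|u - s * v|.
  have := H 1 (normr1 _); have := H (-1) (normrN1 _).
  by rewrite ler_norml !mulr1 mulrN1 !mulN1r mulNr; lra.
move=> c1.
pose g h := tau (u + c * h) - tau (v + s * c * h).
have dg : is_derive (0 : R) 1 g (c * derive1 tau u - s * c * derive1 tau v).
  by apply: is_deriveB; apply: is_derive_shift; exact: dtau.
apply: (derive_le_slope dg).
near=> h.
have h0 : 0 < h by near: h; exact: nbhs_right_gt.
have hu : h < u by near: h; exact: nbhs_right_lt.
have hv : h < v by near: h; exact: nbhs_right_lt.
have ch : `|c * h| = h by rewrite normrM c1 mul1r gtr0_norm.
have cu : 0 < u + c * h by have := ler_norm (- (c * h)); rewrite normrN ch; lra.
have sch : `|s * c * h| = h by rewrite -mulrA normrM s1 mul1r.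
have cv : 0 < v + s * c * h.
  by have := ler_norm (- (s * c * h)); rewrite normrN sch; lra.
have qp : u + c * h - u = c * h by ring.
have zp : u - (u - s * v) = s * v by ring.
have zq : u + c * h - (u - s * v) = s * (v + s * c * h).
  by transitivity (c * h * (s * s) + s * v); [rewrite ss; ring | ring].
have := quadruple_bound_line 0 (u - s * v) (u + c * h) u tauL.
rewrite /g !mulr0 !addr0 !subr0 (gtr0_norm u0) (gtr0_norm cu) qp zp zq.
rewrite ch [`|s * v|]normrM normrM s1 !mul1r (gtr0_norm v0) (gtr0_norm cv) => H.
suff : uniq [:: 0; u - s * v; u + c * h; u] by move=> /H; lra.
have neq_sub (x y : R) : `|y - x| != 0 -> x != y.
  by rewrite normr_eq0 subr_eq0 eq_sym.
rewrite /= !inE !negb_or andbT (eq_sym 0) w0 (lt_eqF u0) (lt_eqF cu)/=.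
apply/andP; split; [apply/andP; split|]; apply: neq_sub.
- by rewrite zq normrM s1 mul1r gtr0_norm ?gt_eqF.
- by rewrite zp normrM s1 mul1r gtr0_norm ?gt_eqF.
- by rewrite distrC qp ch gt_eqF.
Unshelve. all: by end_near. Qed.

(** The case [s = -1], [u = v = t] of [derive1_combination_le] reads
    [2 * |tau'(t)| <= L * tau'(2 * t)]: at [t = w] it forces [L > 0], and then
    at [t = x / 2] it gives the sign of [tau'(x)]. *)
Lemma derive1_ge0 {R : realType} {tau : R -> R} {L : R} (w x : R) :
  (forall x, 0 < x -> derivable tau x 1) -> quadruple_bound tau L -> 0 <= L ->
  0 < w -> derive1 tau w != 0 -> 0 < x -> 0 <= derive1 tau x.
Proof.
move=> dtau tauL L0 w0 dw0 x0.
have D t : 0 < t -> `|derive1 tau t *+ 2| <= L * derive1 tau (t *+ 2).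
  move=> t0; have t20 : 0 < t *+ 2 by rewrite pmulrn_lgt0.
  have := derive1_combination_le t t (-1) dtau tauL t0 t0 (normrN1 _).
  rewrite !mulN1r !opprK -!mulr2n (gtr0_norm t20); apply.
  by rewrite gt_eqF.
have L_gt0 : 0 < L.
  rewrite lt_neqAle L0 andbT; apply: contra_neq dw0 => L_eq0.
  by have := D w w0; rewrite -L_eq0 mul0r normr_le0 mulrn_eq0/= => /eqP.
have x20 : 0 < x / 2 by rewrite divr_gt0.
have := D _ x20; rewrite -[(x / 2) *+ 2]mulr_natr divfK//.
by move=> /(le_trans (normr_ge0 _)); rewrite pmulr_rge0.
Qed.

(** Monotonicity of [tau] is what makes the limit defining [value_at0 tau]
    exist; without it [lim] would carry no information. *)
Lemma value_at0_ge {R : realType} {tau f : R -> R} {c : R} :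
  (forall x, 0 < x -> derivable tau x 1) ->
  (forall x, 0 < x -> 0 <= derive1 tau x) ->
  f x @[x --> 0^'+] --> c -> (\forall x \near 0^'+, f x <= tau x) ->
  (c%:E <= value_at0 tau)%E.
Proof.
move=> dtau tau'0 fc ftau.
have tau_ndecr (x y : R) : 0 < x -> x <= y -> tau x <= tau y.
  move=> x0 xy; apply: (@ger0_derive1_ndecry _ tau x _ _ _ x y) => // [t|t|].
  - by rewrite in_itv/= andbT => xt; apply: dtau; exact: lt_trans xt.
  - by rewrite in_itv/= andbT => xt; apply: tau'0; exact: lt_trans xt.
  - apply: derivable_within_continuous => t; rewrite in_itv/= andbT => xt.
    by apply: dtau; exact: lt_le_trans xt.
have cvg_tau : cvg ((tau x)%:E @[x --> 0^'+]).
  apply: nondecreasing_at_right_is_cvge; near=> b => x y.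
  rewrite !in_itv/= => /andP[x0 _] _ xy.
  by rewrite lee_fin tau_ndecr.
have fc_fin : (EFin \o f) x @[x --> 0^'+] --> c%:E.
  by apply: cvg_EFin; [exact: nearW|exact: fc].
apply: (lee_cvg_to fc_fin cvg_tau).
by near=> x; rewrite /= lee_fin; near: x; exact: ftau.
Unshelve. all: by end_near. Qed.

(** A finite lower bound on [value_at0 tau] is enough for (i) and (ii): it rules
    out the value -oo, and the value +oo only makes the quotient smaller. *)
Lemma value_at0_quotient_le {R : realType} {tau : R -> R} {a c d k L : R} :
  (c%:E <= value_at0 tau)%E -> 0 <= k -> 0 < d -> k * (a - c) <= L * d ->
  (k%:E * (a%:E - value_at0 tau) / d%:E <= L%:E)%E.
Proof.
move=> cV k0 d0 acd; rewrite inver gt_eqF// lee_pdivrMr// -EFinM.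
apply: (@le_trans _ _ (k%:E * (a%:E - c%:E))%E); last first.
  by rewrite -EFinB -EFinM lee_fin.
by apply: lee_wpmul2l; [rewrite lee_fin|exact: leeB].
Qed.

Theorem proposition9 (R : realType) (tau : R -> R) (u v : R)
    (htau : quadruple_transformation tau) (hu : 0 < u) (hv : 0 < v) :
  [/\ u * derive1 tau u != 0 ->
      (2%:E * ((tau u)%:E - value_at0 tau) / (u * derive1 tau u)%R%:E
         <= (quadruple_const tau)%:E)%E,
      2 * u * derive1 tau u != 0 ->
      (((tau (2 * u)%R)%:E - value_at0 tau) / (2 * u * derive1 tau u)%R%:E
         <= (quadruple_const tau)%:E)%E,
      derive_ext tau `|u - v| != 0%E ->
      ((derive1 tau u - derive1 tau v)%R%:E / derive_ext tau `|u - v|%R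
         <= (quadruple_const tau)%:E)%E
    & derive1 tau (u + v) != 0 ->
      (derive1 tau u + derive1 tau v) / derive1 tau (u + v)
        <= quadruple_const tau].
Proof.
have [[L0 tauL] _] := quadruple_constP htau; case: htau => dtau _.
set L := quadruple_const tau in L0 tauL *.
have tau'_gt0 w : 0 < w -> derive1 tau w != 0 -> 0 < derive1 tau w.
  by move=> w0 dw; rewrite lt_neqAle eq_sym dw (derive1_ge0 w w dtau tauL).
split.
- rewrite mulf_eq0 gt_eqF//= => du0.
  have tau'0 x := derive1_ge0 u x dtau tauL L0 hu du0.
  have du := tau'_gt0 _ hu du0.
  (* The quadruple [0], [u], [u + h], [h], solved for [tau h]. *)
  pose f h := (tau (u + 1 * h) + tau (u + -1 * h) - L * u * derive1 tau u) / 2.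
  have fc : f h @[h --> 0^'+] --> (tau u + tau u - L * u * derive1 tau u) / 2.
    apply: cvgMl; apply: cvgB; last exact: cvg_cst.
    by apply: cvgD; apply: cvg_shift_at_right; exact: dtau.
  apply: (value_at0_quotient_le (value_at0_ge dtau tau'0 fc _)) => //.
  + near=> h.
    have h0 : 0 < h by near: h; exact: nbhs_right_gt.
    have hu' : h < u by near: h; exact: nbhs_right_lt.
    have uh0 : 0 < u + h by exact: addr_gt0.
    have hu0 : 0 < u - h by rewrite subr_gt0.
    have := quadruple_bound_line 0 u (u + h) h tauL.
    have qz : u + h - u = h by ring.
    rewrite !subr0 addrK qz (distrC h) !gtr0_norm// => H.
    rewrite /f mul1r mulN1r; suff /H : uniq [:: 0; u; u + h; h] by lra.
    by rewrite /= !inE !negb_or !neq_lt; lra.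
  + by rewrite mulr_gt0.
  + lra.
- rewrite -mulrA mulf_eq0 gt_eqF//= mulf_eq0 gt_eqF//= => du0.
  have tau'0 x := derive1_ge0 u x dtau tauL L0 hu du0.
  have du := tau'_gt0 _ hu du0.
  (* The quadruple [0], [u], [2 * u], [h], solved for [tau h]. *)
  pose f h :=
    tau (2 * u) - tau u + tau (u + -1 * h) - L * (2 * u - h) * derive1 tau u.
  have fc : f h @[h --> 0^'+] -->
      tau (2 * u) - tau u + tau u - L * (2 * u - 0) * derive1 tau u.
    apply: cvgB.
      by apply: cvgD; [exact: cvg_cst|apply: cvg_shift_at_right; exact: dtau].
    apply: cvgMl; apply: cvgMr; apply: cvgB; first exact: cvg_cst.
    by apply: cvg_at_right_filter; exact: cvg_id.
  rewrite -[X in (X / _)%E]mul1e.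
  apply: (value_at0_quotient_le (value_at0_ge dtau tau'0 fc _)) => //.
  + near=> h.
    have h0 : 0 < h by near: h; exact: nbhs_right_gt.
    have hu' : h < u by near: h; exact: nbhs_right_lt.
    have hu0 : 0 < u - h by rewrite subr_gt0.
    have u20 : 0 < 2 * u by rewrite mulr_gt0.
    have qp0 : 0 < 2 * u - h by lra.
    have qz : 2 * u - u = u by ring.
    have := quadruple_bound_line 0 u (2 * u) h tauL.
    rewrite !subr0 qz (distrC h) !gtr0_norm// => H.
    rewrite /f mulN1r; suff /H : uniq [:: 0; u; 2 * u; h] by lra.
    by rewrite /= !inE !negb_or !neq_lt; lra.
  + by rewrite !mulr_gt0.
  + lra.
(* For [u = v] the denominator is the inferior limit at 0, possibly infinite,
   but the numerator vanishes. *)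
- have [->|uv] := eqVneq u v.
    by rewrite (subrr (derive1 tau v)) mul0e lee_fin.
  have w0 : 0 < `|u - v| by rewrite normr_gt0 subr_eq0.
  rewrite /derive_ext (gt_eqF w0) eqe => dw; have := tau'_gt0 _ w0 dw => dw_gt0.
  rewrite inver gt_eqF// lee_pdivrMr// -EFinM lee_fin.
  apply: le_trans (ler_norm _) _.
  have := derive1_combination_le u v 1 dtau tauL hu hv (normr1 _).
  by rewrite !mul1r subr_eq0; exact.
- move=> dw; have uv0 := addr_gt0 hu hv.
  rewrite ler_pdivrMr ?tau'_gt0//; apply: le_trans (ler_norm _) _.
  have := derive1_combination_le u v (-1) dtau tauL hu hv (normrN1 _).
  by rewrite !mulN1r !opprK (gtr0_norm uv0); apply; rewrite gt_eqF.
Unshelve. all: by end_near. Qed.
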